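(* Let $(V,\phi,\alpha_1,\ldots,\alpha_{n-1})$ be an $n$-Hom-Nambu-Lie algebra over $\mathbb{K}$, let $\tau:V\to\mathbb{K}$ be a $\phi$-trace, and let $\alpha_n:V\to V$ be a linear map. If $$\tau(\alpha_i(x))\,\tau(y)=\tau(x)\,\tau(\alpha_i(y))$$ and $$\tau(\alpha_i(x))\,\alpha_j(y)=\tau(\alpha_j(y))\,\alpha_i(x)$$ for all $i,j\in\{1,\ldots,n\}$ and all $x,y\in V$, then $(V,\phi_\tau,\alpha_1,\ldots,\alpha_n)$ is an $(n+1)$-Hom-Nambu-Lie algebra.
   Context: $\mathbb{K}$ is a field of characteristic $0$, $V$ is a vector space over $\mathbb{K}$, and $n$ is a positive integer. An $n$-Hom-Nambu-Lie algebra $(V,[\cdot,\ldots,\cdot],\alpha_1,\ldots,\alpha_{n-1})$ is a vector space $V$ together with a (totally) skew-symmetric $n$-linear map $[\cdot,\ldots,\cdot]:V^n\to V$ and linear maps $\alpha_1,\ldots,\alpha_{n-1}:V\to V$ (the twisting maps) such that $$[\alpha_1(x_1),\ldots,\alpha_{n-1}(x_{n-1}),[y_1,\ldots,y_n]]=\sum_{k=1}^n[\alpha_1(y_1),\ldots,\alpha_{k-1}(y_{k-1}),[x_1,\ldots,x_{n-1},y_k],\alpha_k(y_{k+1}),\ldots,\alpha_{n-1}(y_n)]$$ for all $x_1,\ldots,x_{n-1},y_1,\ldots,y_n\in V$. For $\phi:V^n\to V$, a $\phi$-trace is a linear map $\tau:V\to\mathbb{K}$ such that $\tau(\phi(x_1,\ldots,x_n))=0$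 for all $x_1,\ldots,x_n\in V$. For an $n$-linear map $\phi:V^n\to V$ and $\tau:V\to\mathbb{K}$, the map $\phi_\tau:V^{n+1}\to V$ is defined by $$\phi_\tau(x_1,\ldots,x_{n+1})=\sum_{k=1}^{n+1}(-1)^k\tau(x_k)\,\phi(x_1,\ldots,\hat{x}_k,\ldots,x_{n+1}),$$ where $\hat{x}_k$ means that $x_k$ is omitted. *)

(* Defs.v *)
From HB Require Import structures.
From mathcomp Require Import all_boot all_order all_algebra all_fingroup.
Set Implicit Arguments.
Unset Strict Implicit.
Unset Printing Implicit Defensive.
Import GRing.Theory.
Local Open Scope ring_scope.

(* Indices are shifted by one: a list x_1, ..., x_n is a family indexed       *)
(* by 'I_n = {0, ..., n - 1}.  Arguments of brackets are finite functions, so *)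
(* that extensionally equal argument lists are equal.                         *)
Section Brackets.

Variables (K : fieldType) (V : lmodType K) (n : nat).
Implicit Types (phi : {ffun 'I_n -> V} -> V) (x y : {ffun 'I_n -> V}).

Definition replace_arg x (i : 'I_n) (u : V) : {ffun 'I_n -> V} :=
  [ffun j => if j == i then u else x j].

Definition multilinear phi : Prop :=
  forall x (i : 'I_n), linear (fun u => phi (replace_arg x i u)).

Definition skew_symmetric phi : Prop :=
  forall x (s : 'S_n), phi [ffun j => x (s j)] = (-1) ^+ s *: phi x.

(* (z_1, ..., z_{n-1}, u) when 0 < n: insub fails exactly on the last index.  *)
Definition append_last T (z : 'I_n.-1 -> T) (u : T) (j : 'I_n) : T :=
  if insub (val j) is Some i then z i else u.

(* (a_1 y_1, ..., a_{k-1} y_{k-1}, u, a_k y_{k+1}, ..., a_{n-1} y_n):         *)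
(* unlift k j is None for j = k, and otherwise the rank of j in 'I_n minus k. *)
Definition twist_around (alpha : 'I_n.-1 -> {linear V -> V}) y (k : 'I_n)
    (u : V) : {ffun 'I_n -> V} :=
  [ffun j => if unlift k j is Some i then alpha i (y j) else u].

Definition hom_nambu_identity phi (alpha : 'I_n.-1 -> {linear V -> V}) : Prop :=
  forall (x : {ffun 'I_n.-1 -> V}) y,
    phi (finfun (append_last (fun i => alpha i (x i)) (phi y))) =
    \sum_(k < n) phi (twist_around alpha y k (phi (finfun (append_last x (y k))))).

(* Meaningful for 0 < n only. *)
Record is_hom_nambu_lie phi (alpha : 'I_n.-1 -> {linear V -> V}) : Prop := {
  hnl_multilinear : multilinear phi;
  hnl_skew_symmetric : skew_symmetric phi;
  hnl_identity : hom_nambu_identity phi alpha }.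

Definition is_trace phi (tau : {scalar V}) : Prop :=
  forall x, tau (phi x) = 0.

(* The exponent is k.+1 because k is counted from 0. *)
Definition bracket_trace phi (tau : {scalar V}) (x : {ffun 'I_n.+1 -> V}) : V :=
  \sum_(k < n.+1)
    ((-1) ^+ k.+1 * tau (x k)) *: phi [ffun j : 'I_n => x (lift k j)].

End Brackets.

(* Main.v *)
Require Import Defs.
From mathcomp Require Import all_boot all_order all_algebra all_fingroup.
Import GRing.Theory.
Local Open Scope ring_scope.

(** Write A_1, ..., A_n for the twisting maps and psi for the bracket built
    from phi and tau.  That psi is multilinear is immediate, and that it is
    skew-symmetric is a Laplace-expansion argument: removing the argument k
    from a family permuted by s amounts to removing s k from the family and
    permuting the rest, at the cost of the sign of s times (-1)^(k + s k).

    Every bracket occurring in the Nambu identity of psi has one argument w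
    that is a value of psi, hence killed by tau, while its other arguments are
    values of twisting maps, hence satisfy tau(u) v = tau(v) u pairwise.  If tau
    kills all the arguments then psi vanishes on them by definition.  If tau is
    nonzero on one of them, all the arguments other than w are multiples of it;
    as soon as n > 1 there are at least two such arguments, so psi, being
    alternating, vanishes.  Thus for n > 1 both sides of the identity are zero
    ([bracket_trace_eq0]).

    For n = 1 the brackets have a single argument besides w, and the identity is
    a direct computation from psi(u, v) = tau(v) phi(u) - tau(u) phi(v) and
    the relation tau(A u) tau(v) = tau(u) tau(A v)
    ([bracket_trace1_identity]). *)

(** * Alternating multilinear maps *)

Section Alternating.

Variables (K : fieldType) (V : lmodType K) (n : nat).
Variable phi : {ffun 'I_n -> V} -> V.
Hypotheses (phi_lin : multilinear phi) (phi_skew : skew_symmetric phi).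

Lemma multilinearZ (x : {ffun 'I_n -> V}) i c u :
  phi (replace_arg x i (c *: u)) = c *: phi (replace_arg x i u).
Proof.
have lin := phi_lin x i.
have phi0 : phi (replace_arg x i 0) = 0.
  by have := lin (-1) 0 0; rewrite scaler0 addr0 scaleN1r addNr.
by have := lin c u 0; rewrite /= phi0 !addr0.
Qed.

(** Exchanging the two equal arguments changes the sign of the value, which
    must then be zero since 2 is invertible. *)
Lemma skew_symmetric_eq0 (x : {ffun 'I_n -> V}) i j :
  2%:R != 0 :> K -> i != j -> x i = x j -> phi x = 0.
Proof.
move=> two_neq0 neq_ij eq_x; have := phi_skew x (tperm i j).
have -> : [ffun l => x (tperm i j l)] = x.
  by apply/ffunP=> l; rewrite ffunE; case: tpermP => [->|->|].
rewrite odd_tperm neq_ij expr1 scaleN1r => /eqP.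
rewrite -addr_eq0 -mulr2n -scaler_nat scaler_eq0 (negPf two_neq0).
by move/eqP.
Qed.

Lemma alternating_proportional_eq0 (x : {ffun 'I_n -> V}) i j c :
  2%:R != 0 :> K -> i != j -> x j = c *: x i -> phi x = 0.
Proof.
move=> two_neq0 neq_ij xj.
have -> : x = replace_arg x j (c *: x i).
  by apply/ffunP=> l; rewrite ffunE; case: eqP => // ->.
rewrite multilinearZ (@skew_symmetric_eq0 _ i j) ?scaler0 //.
by rewrite !ffunE eqxx (negPf neq_ij).
Qed.

End Alternating.

(** * Removing one argument *)

Section BracketTrace.

Variables (K : fieldType) (V : lmodType K) (n : nat).
Variables (phi : {ffun 'I_n -> V} -> V) (tau : {scalar V}).

(** The permutation induced by [s] between the complements of [k] and [s k],
    both of them identified with ['I_n] by [lift]. *)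
Lemma perm_lift_ex (s : 'S_n.+1) (k : 'I_n.+1) :
  exists t : 'S_n, s = lift_perm k (s k) t.
Proof.
have s_lift j : s k != s (lift k j) by rewrite (inj_eq perm_inj) neq_lift.
pose f j := sval (unlift_some (s_lift j)).
have lift_f j : s (lift k j) = lift (s k) (f j).
  by rewrite /f; case: unlift_some.
have f_inj : injective f.
  move=> j l eq_f; apply/(@lift_inj _ k)/(@perm_inj _ s).
  by rewrite !lift_f eq_f.
exists (perm f_inj); apply/permP=> i; case: (unliftP k i) => [j|] ->.
  by rewrite lift_perm_lift permE lift_f.
by rewrite lift_perm_id.
Qed.

Lemma bracket_trace_multilinear :
  multilinear phi -> multilinear (bracket_trace phi tau).
Proof.
move=> phi_lin x i c u v; rewrite /bracket_trace /= scaler_sumr -big_split /=.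
apply: eq_bigr => k _; rewrite !ffunE.
case: (unliftP k i) => [l ->|->].
  (* For k different from i the substitution takes place inside phi. *)
  have repl w : [ffun j => replace_arg x (lift k l) w (lift k j)] =
                replace_arg [ffun j => x (lift k j)] l w.
    by apply/ffunP=> j; rewrite !ffunE (inj_eq lift_inj).
  rewrite (negPf (neq_lift _ _)) !repl phi_lin scalerDr !scalerA.
  by rewrite [c * _]mulrC.
rewrite eqxx.
have repl w : [ffun j => replace_arg x k w (lift k j)] =
              [ffun j => x (lift k j)].
  by apply/ffunP=> j; rewrite !ffunE eq_sym (negPf (neq_lift _ _)).
by rewrite !repl linearP /= mulrDr scalerDl scalerA mulrCA.
Qed.

Lemma bracket_trace_skew_symmetric :
  skew_symmetric phi -> skew_symmetric (bracket_trace phi tau).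
Proof.
move=> phi_skew x s; rewrite /bracket_trace scaler_sumr.
rewrite [RHS](reindex_inj (@perm_inj _ s)) /=; apply: eq_bigr => k _.
have [t def_s] := perm_lift_ex s k.
have -> : [ffun j => [ffun l => x (s l)] (lift k j)] =
          [ffun j => [ffun l => x (lift (s k) l)] (t j)].
  by apply/ffunP=> j; rewrite !ffunE def_s lift_perm_lift -def_s.
rewrite phi_skew ffunE !scalerA; congr (_ *: _).
rewrite mulrAC mulrA; congr (_ * _).
rewrite [in X in _ = X * _]def_s odd_lift_perm !signr_addb (signr_odd _ k).
rewrite (signr_odd _ (s k)) !exprS !mulN1r mulNr mulrN; congr (- _).
by rewrite [RHS]mulrAC -(mulrA (_ ^+ k)) -expr2 sqrr_sign mulr1.
Qed.

Lemma bracket_trace_trace :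
  is_trace phi tau -> is_trace (bracket_trace phi tau) tau.
Proof.
move=> tr x; rewrite linear_sum /= big1 // => k _.
by rewrite linearZ /= tr mulr0.
Qed.

(** The arguments off [k] all lie on one line unless [tau] kills every argument;
    since [1 < n] there are two of them, and the bracket is alternating. *)
Lemma bracket_trace_eq0 (z : {ffun 'I_n.+1 -> V}) (k : 'I_n.+1) :
    multilinear phi -> skew_symmetric phi -> 2%:R != 0 :> K -> (1 < n)%N ->
    tau (z k) = 0 ->
    (forall i j, i != k -> j != k -> tau (z i) *: z j = tau (z j) *: z i) ->
  bracket_trace phi tau z = 0.
Proof.
move=> phi_lin phi_skew two_neq0 n_gt1 tau_zk tau_z.
have [/existsP[i tau_zi] | /existsPn tau0] := boolP [exists i, tau (z i) != 0];
    last first.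
  by apply: big1 => i _; have /negPn/eqP-> := tau0 i; rewrite mulr0 scale0r.
have neq_ik : i != k by apply: contraNneq tau_zi => ->; rewrite tau_zk.
have [j /andP[neq_ij neq_jk]] : exists j, (i != j) && (j != k).
  have : (0 < #|~: [set i; k]|)%N.
    by rewrite cardsCs setCK card_ord cards2 neq_ik subn_gt0.
  case/card_gt0P=> j; rewrite !inE negb_or => /andP[neq_ji neq_jk].
  by exists j; rewrite eq_sym neq_ji.
apply: (@alternating_proportional_eq0 _ _ _ _ _ _ _ i j
          ((tau (z i))^-1 * tau (z j))) => //.
- exact: bracket_trace_multilinear.
- exact: bracket_trace_skew_symmetric.
by rewrite -scalerA -tau_z // scalerA mulVf // scale1r.
Qed.

End BracketTrace.

(** * The case of a unary bracket *)

Section Unary.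

Variables (K : fieldType) (V : lmodType K).
Variables (phi : {ffun 'I_1 -> V} -> V) (tau : {scalar V}).

Lemma bracket_trace1E (z : {ffun 'I_2 -> V}) :
  bracket_trace phi tau z =
    tau (z ord_max) *: phi [ffun=> z ord0] -
    tau (z ord0) *: phi [ffun=> z ord_max].
Proof.
rewrite /bracket_trace big_ord_recl big_ord1 addrC /=.
rewrite expr1 expr2 mulrNN !mul1r mulN1r scaleNr.
have -> : lift ord0 ord0 = ord_max :> 'I_2 by apply: val_inj.
by congr (_ *: phi _ - _ *: phi _); apply/ffunP=> j; rewrite !ffunE;
   congr (z _); apply: val_inj; rewrite [j]ord1.
Qed.

Lemma bracket_trace1_identity (A : 'I_1 -> {linear V -> V}) :
    multilinear phi -> is_trace phi tau ->
    (forall i x y, tau (A i x) * tau y = tau x * tau (A i y)) ->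
  hom_nambu_identity (n := 2) (bracket_trace phi tau) A.
Proof.
move=> phi_lin tr tauA x y.
pose f u := phi [ffun=> u].
have repl w : replace_arg [ffun=> 0] ord0 w = [ffun=> w] :> {ffun 'I_1 -> V}.
  by apply/ffunP=> j; rewrite !ffunE [j]ord1 eqxx.
have f_lin c u v : f (c *: u + v) = c *: f u + f v.
  by have := phi_lin [ffun=> 0] ord0 c u v; rewrite /= !repl.
have fZ c u : f (c *: u) = c *: f u.
  by have := multilinearZ _ _ _ _ phi_lin [ffun=> 0] ord0 c u; rewrite !repl.
have fB c d u v : f (c *: u - d *: v) = c *: f u - d *: f v.
  by rewrite f_lin -(scaleNr d v) fZ scaleNr.
have psiE (z : {ffun 'I_2 -> V}) : bracket_trace phi tau z =
    tau (z ord_max) *: f (z ord0) - tau (z ord0) *: f (z ord_max).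
  exact: bracket_trace1E.
have tau_psi (z : {ffun 'I_2 -> V}) : tau (bracket_trace phi tau z) = 0.
  exact: bracket_trace_trace.
have last0 T (g : 'I_1 -> T) u : append_last (n := 2) g u ord0 = g ord0.
  by rewrite /append_last insubT //=; congr g; apply: val_inj.
have lastm T (g : 'I_1 -> T) u : append_last (n := 2) g u ord_max = u.
  by rewrite /append_last insubF.
have unlift0m : unlift ord0 (ord_max : 'I_2) = Some ord0.
  by case: unliftP => // j _; rewrite [j]ord1.
have unliftm0 : unlift ord_max (ord0 : 'I_2) = Some ord0.
  by case: unliftP => // j _; rewrite [j]ord1.
rewrite big_ord_recl big_ord1.
have -> : lift ord0 ord0 = ord_max :> 'I_2 by apply: val_inj.
rewrite ![bracket_trace _ _ (twist_around _ _ _ _)]psiE.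
rewrite [LHS]psiE !ffunE last0 lastm !unlift_none unlift0m unliftm0 !tau_psi.
rewrite !scale0r sub0r subr0 sub0r !psiE !ffunE !last0 !lastm !fB.
set X := x ord0; set y0 := y ord0; set y1 := y ord_max; set a := A ord0.
rewrite !scalerBr !scalerA.
(* The two terms in f (f X) cancel and the others match, each time by the
   relation on tau and a. *)
have e0 := tauA ord0 y0 y1; have e1 := tauA ord0 X y0.
have e2 := tauA ord0 X y1; rewrite -/a in e0 e1 e2.
rewrite e0 e1 e2 ![tau X * _]mulrC [tau y0 * _]mulrC.
by rewrite !opprB [RHS]addrC addrA subrK.
Qed.

End Unary.

Theorem theorem3p4 (K : fieldType) (charK0 : [pchar K] =i pred0)
    (V : lmodType K) (n : nat) (n_gt0 : (0 < n)%N)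
    (phi : {ffun 'I_n -> V} -> V) (alpha : 'I_n.-1 -> {linear V -> V})
    (alpha_n : {linear V -> V}) (tau : {scalar V})
    (phi_hnl : is_hom_nambu_lie phi alpha)
    (tau_trace : is_trace phi tau)
    (tau_alpha : forall (i : 'I_n) (x y : V),
       tau (append_last alpha alpha_n i x) * tau y =
       tau x * tau (append_last alpha alpha_n i y))
    (alpha_alpha : forall (i j : 'I_n) (x y : V),
       tau (append_last alpha alpha_n i x) *: append_last alpha alpha_n j y =
       tau (append_last alpha alpha_n j y) *: append_last alpha alpha_n i x) :
  is_hom_nambu_lie (n := n.+1) (bracket_trace phi tau) (append_last alpha alpha_n).
Proof.
have two_neq0 : 2%:R != 0 :> K.
  by apply/negP=> two0; have := charK0 2; rewrite !inE two0.
have [phi_lin phi_skew _] := phi_hnl.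
split.
- exact: bracket_trace_multilinear.
- exact: bracket_trace_skew_symmetric.
have [n_gt1 | ] := ltnP 1 n; last first.
  move=> n_le1; have n1 : n = 1%N by apply/eqP; rewrite eqn_leq n_le1.
  move: (append_last alpha alpha_n) tau_alpha => A tauA.
  clear - phi_lin tau_trace tauA n1; subst n.
  exact: bracket_trace1_identity.
move: (append_last alpha alpha_n) alpha_alpha => A tauA x y.
have tau_psi := bracket_trace_trace _ _ _ _ _ tau_trace.
rewrite (@bracket_trace_eq0 _ _ _ _ _ _ ord_max) //.
- rewrite big1 // => k _; apply: (@bracket_trace_eq0 _ _ _ _ _ _ k) => //.
    by rewrite ffunE unlift_none tau_psi.
  move=> i j; rewrite ![_ == k]eq_sym.
  move=> /unlift_some[i' _ ei] /unlift_some[j' _ ej].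
  by rewrite !ffunE ei ej.
- by rewrite ffunE /append_last insubF ?ltnn // tau_psi.
have lt_last (i : 'I_n.+1) : i != ord_max -> (val i < n)%N.
  by move=> neq_i; rewrite ltn_neqAle -ltnS ltn_ord andbT.
move=> i j /lt_last lt_i /lt_last lt_j.
by rewrite !ffunE /append_last !insubT.
Qed.
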